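(* Let assumptions A1 and A2 (see context) hold, let $\rho_0,\rho_1$ be two probability density functions on $\mathbb{R}^n$ having finite second moments, let $[t_0,t_1]$ be a given time horizon, and let the state cost $q$ be suitably smooth. Let the pair $(\rho^{\bm u}_{\mathrm{opt}},S)$, with $S\in\mathcal{C}^{1,2}([t_0,t_1];\mathbb{R}^n)$, solve the system $$\frac{\partial\rho^{\bm u}_{\mathrm{opt}}}{\partial t}+\nabla_{\bm x}\cdot\left(\rho^{\bm u}_{\mathrm{opt}}\left(\bm f+\bm g\bm g^{\top}\nabla_{\bm x}S\right)\right)=\tfrac12\Delta_{\bm\Sigma}\,\rho^{\bm u}_{\mathrm{opt}},$$ $$\frac{\partial S}{\partial t}+\langle\nabla_{\bm x}S,\bm f\rangle+\tfrac12\langle\nabla_{\bm x}S,\bm g\bm g^{\top}\nabla_{\bm x}S\rangle+\tfrac12\langle\bm\Sigma,\mathrm{Hess}_{\bm x}S\rangle=q,$$ $$\rho^{\bm u}_{\mathrm{opt}}(t_0,\cdot)=\rho_0(\cdot),\qquad \rho^{\bm u}_{\mathrm{opt}}(t_1,\cdot)=\rho_1(\cdot),$$ which constitutes the necessary conditions for optimality of the control-affine Schr\''odinger bridge problem (P) stated in the context (with optimal control $\bm u_{\mathrm{opt}}=\bm g^{\top}\nabla_{\bm x}S$). For a constant $\lambda>0$, define $$\widehat\varphi:=\rho^{\bm u}_{\mathrm{opt}}\exp(-S/\lambda),\qquad \varphi:=\exp(S/\lambda).$$ Then the pair $(\widehat\varphi,\varphi)$ solves $$\frac{\partial\widehat\varphi}{\partial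 t}+\nabla_{\bm x}\cdot\left(\widehat\varphi\left(\bm f+\bm f_{\varphi}\right)\right)-\tfrac12\Delta_{\bm\Sigma}\,\widehat\varphi+\left(\frac{q}{\lambda}+q_{\varphi}\right)\widehat\varphi=0,$$ $$\frac{\partial\varphi}{\partial t}+\langle\nabla_{\bm x}\varphi,\bm f+\bm f_{\varphi}\rangle+\tfrac12\langle\bm\Sigma,\mathrm{Hess}_{\bm x}\varphi\rangle-\left(\frac{q}{\lambda}+q_{\varphi}\right)\varphi=0,$$ $$\widehat\varphi(t_0,\cdot)\,\varphi(t_0,\cdot)=\rho_0(\cdot),\qquad \widehat\varphi(t_1,\cdot)\,\varphi(t_1,\cdot)=\rho_1(\cdot),$$ where $$\bm f_{\varphi}:=\left(\lambda\bm g\bm g^{\top}-\bm\Sigma\right)\nabla_{\bm x}\log\varphi,\qquad q_{\varphi}:=\tfrac12\left(\nabla_{\bm x}\log\varphi\right)^{\top}\left(\lambda\bm g\bm g^{\top}-\bm\Sigma\right)\nabla_{\bm x}\log\varphi.$$ The minimizing pair $(\rho^{\bm u}_{\mathrm{opt}},\bm u_{\mathrm{opt}})$ for problem (P) is then recovered, for all $t\in[t_0,t_1]$, from $$\rho^{\bm u}_{\mathrm{opt}}(t,\cdot)=\widehat\varphi(t,\cdot)\,\varphi(t,\cdot),\qquad \bm u_{\mathrm{opt}}(t,\cdot)=\lambda\,\bm g^{\top}\nabla_{(\cdot)}\log\varphi(t,\cdot).$$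
   Context: Here $\bm f:[t_0,t_1]\times\mathbb{R}^n\to\mathbb{R}^n$ is the unforced drift, $\bm g:[t_0,t_1]\times\mathbb{R}^n\to\mathbb{R}^{n\times m}$ the control coefficient, $\bm\sigma:[t_0,t_1]\times\mathbb{R}^n\to\mathbb{R}^{n\times p}$ the noise (diffusion) coefficient, and $q:[t_0,t_1]\times\mathbb{R}^n\to\mathbb{R}$ the state cost; arguments $(t,\bm x)$ are suppressed. The diffusion tensor is $\bm\Sigma:=\bm\sigma\bm\sigma^{\top}\succeq\bm 0$. The controlled It\^o diffusion is $\mathrm{d}\bm x_t^{\bm u}=(\bm f(t,\bm x_t^{\bm u})+\bm g(t,\bm x_t^{\bm u})\bm u)\,\mathrm{d}t+\bm\sigma(t,\bm x_t^{\bm u})\,\mathrm{d}\bm w_t$ with $\bm w_t\in\mathbb{R}^p$ standard Brownian motion. Assumption A1: there exist constants $c_1,c_2>0$ such that for all $\bm x,\bm y\in\mathbb{R}^n$ and $t\in[t_0,t_1]$, $\|\bm f(t,\bm x)\|_2+\|\bm\sigma(t,\bm x)\|_2\le c_1(1+\|\bm x\|_2)$ and $\|\bm f(t,\bm x)-\bm f(t,\bm y)\|_2\le c_2\|\bm x-\bm y\|_2$. Assumption A2: there exists $c_3>0$ such that for all $\bm x\in\mathbb{R}^n$ and $t\in[t_0,t_1]$, $\langle\bm x,\bm\Sigma(t,\bm x)\bm x\rangle\ge c_3\|\bm x\|_2^2$. $\langle\cdot,\cdot\rangle$ is the Euclidean inner product for vectors and the Frobenius inner product for matrices. $\mathrm{Hess}_{\bm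 x}$ denotes the Hessian with respect to $\bm x$. The weighted Laplacian is $\Delta_{\bm\Sigma(t,\bm x)}\,\rho:=\sum_{i,j=1}^n\frac{\partial^2}{\partial x_i\partial x_j}\left(\bm\Sigma_{ij}(t,\bm x)\rho(t,\bm x)\right)$. $\mathcal{C}^{1,2}([t_0,t_1];\mathbb{R}^n)$ denotes real-valued functions of $(t,\bm x)\in[t_0,t_1]\times\mathbb{R}^n$ that are $C^1$ in $t$ and $C^2$ in $\bm x$. The set of admissible controls is $\mathcal{U}:=\{\bm v:[t_0,t_1]\times\mathbb{R}^n\to\mathbb{R}^m\mid\|\bm v\|_2^2<\infty\}$ (Markovian finite energy inputs). The set of admissible density curves is $\mathcal{P}_{01}:=\{t\mapsto\rho(t,\cdot)\text{ continuous}\mid\rho\ge0,\ \int\rho(t,\cdot)=1\ \forall t\in[t_0,t_1],\ \rho(t_0,\cdot)=\rho_0(\cdot),\ \rho(t_1,\cdot)=\rho_1(\cdot)\}$. Problem (P), the control-affine Schr\''odinger bridge problem: find $$\underset{(\rho^{\bm u},\bm u)\in\mathcal{P}_{01}\times\mathcal{U}}{\arg\inf}\int_{t_0}^{t_1}\mathbb{E}_{\rho^{\bm u}}\left[q(t,\bm x_t^{\bm u})+\tfrac12\|\bm u\|_2^2\right]\mathrm{d}t$$ subject to $\frac{\partial\rho^{\bm u}}{\partial t}+\nabla_{\bm x}\cdot\left(\rho^{\bm u}(\bm f+\bm g\bm u)\right)=\tfrac12\Delta_{\bm\Sigma}\,\rho^{\bm u}$. *)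

(* Defs.v *)
From HB Require Import structures.
From mathcomp Require Import all_boot all_order all_algebra.
From mathcomp Require Import all_classical all_reals all_analysis.

Set Implicit Arguments.
Unset Strict Implicit.
Unset Printing Implicit Defensive.

Import Order.TTheory GRing.Theory Num.Theory.
Import numFieldNormedType.Exports.

Local Open Scope classical_set_scope.
Local Open Scope ring_scope.

Section cons_measure.
Context d (T : measurableType d) (R : realType) (n : nat).
Variable m1 : {sigma_finite_measure set T -> \bar R}.
Variable m2 : {sigma_finite_measure set (n.-tuple T) -> \bar R}.

Definition tuple_cons (z : T * n.-tuple T) : n.+1.-tuple T :=
  [tuple of z.1 :: z.2].

Lemma measurable_tuple_cons : measurable_fun setT tuple_cons.
Proof. exact: measurable_cons. Qed.

Definition cons_measure : set (n.+1.-tuple T) -> \bar R :=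
  pushforward (m1 \x m2)%E tuple_cons.

Let measurable_consI A : measurable A -> measurable (tuple_cons @^-1` A).
Proof.
by move=> mA; rewrite -[X in measurable X]setTI; exact: measurable_tuple_cons.
Qed.

Let cons_measure0 : cons_measure set0 = 0%E.
Proof. by rewrite /cons_measure /pushforward preimage_set0 measure0. Qed.

Let cons_measure_ge0 A : (0 <= cons_measure A)%E.
Proof. by rewrite /cons_measure /pushforward measure_ge0. Qed.

Let cons_measure_sigma_additive : semi_sigma_additive cons_measure.
Proof.
move=> F mF tF mUF; rewrite /cons_measure /pushforward preimage_bigcup.
apply: measure_semi_sigma_additive.
- by move=> k; exact: measurable_consI.
- apply/trivIsetP => /= i j _ _ ij; rewrite -preimage_setI.
  by move/trivIsetP : tF => /(_ _ _ _ _ ij) ->//; rewrite preimage_set0.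
- by rewrite -preimage_bigcup; exact: measurable_consI.
Qed.

HB.instance Definition _ := isMeasure.Build _ _ _ cons_measure
  cons_measure0 cons_measure_ge0 cons_measure_sigma_additive.

Let cons_measure_sigma_finite : sigma_finite setT cons_measure.
Proof.
have [F FT Foo] : sigma_finite setT (m1 \x m2)%E.
  have /sigma_finiteP[F [FT ndF Foo]] := sigma_finiteT m1.
  have /sigma_finiteP[G [GT ndG Goo]] := sigma_finiteT m2.
  exists (fun k => F k `*` G k).
    rewrite -setXTT FT GT; apply/seteqP; split=> [[x y]|[x y] [k _ [/= Fk Gk]]].
      move=> [/= [i _ Fi] [j _ Gj]]; exists (maxn i j) => //; split.
        by move: x Fi; exact/subsetPset/ndF/leq_maxl.
      by move: y Gj; exact/subsetPset/ndG/leq_maxr.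
    by split; exists k.
  move=> k; have [mF Flt] := Foo k; have [mG Glt] := Goo k.
  split; first exact: measurableX.
  by rewrite product_measure1E// lte_mul_pinfty// ge0_fin_numE.
pose uncons (v : n.+1.-tuple T) := (thead v, [tuple of behead v]).
have muncons : measurable_fun setT uncons.
  apply/measurable_fun_pair; first exact: measurable_tnth.
  exact: measurable_behead.
have consK : cancel tuple_cons uncons.
  move=> [x t]; rewrite /uncons /tuple_cons /= theadE; congr pair.
  exact/val_inj.
exists (fun k => uncons @^-1` F k); first by rewrite -preimage_bigcup -FT.
move=> k; have [mF Flt] := Foo k; split.
  by rewrite -[X in measurable X]setTI; exact: muncons.
rewrite /cons_measure /pushforward -comp_preimage.
by rewrite (_ : uncons \o tuple_cons = id) ?preimage_id//; exact/funext.
Qed.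

HB.instance Definition _ := Measure_isSigmaFinite.Build _ _ _ cons_measure
  cons_measure_sigma_finite.

End cons_measure.

(* Lebesgue measure on R^n, as an iterated product.  The library gives a
   sigma-algebra to n.-tuple R but not to 'cV[R]_n, so integrals over R^n are
   taken over tuples, transported by vec_of_tuple. *)
Fixpoint lebesgue_tuple (R : realType) (n : nat) :
    {sigma_finite_measure set (n.-tuple (measurableTypeR R)) -> \bar R} :=
  match n with
  | 0 => \d_([tuple] : 0.-tuple (measurableTypeR R))
  | k.+1 => cons_measure (@lebesgue_measure R) (lebesgue_tuple R k)
  end.

Section euclidean.
Context {R : realType}.

Definition vec_of_tuple (n : nat) (v : n.-tuple (measurableTypeR R)) : 'cV[R]_n :=
  \col_i tnth v i.

Definition expectation (n : nat) (r h : 'cV[R]_n -> R) : \bar R :=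
  (\int[lebesgue_tuple R n]_v (h (vec_of_tuple v) * r (vec_of_tuple v))%:E)%E.

Definition is_pdf (n : nat) (r : 'cV[R]_n -> R) : Prop :=
  [/\ measurable_fun setT (r \o @vec_of_tuple n),
      forall x, 0 <= r x &
      expectation r (fun=> 1) = 1%E].

(* Euclidean inner product on column vectors, Frobenius on matrices. *)
Definition inner (a b : nat) (A B : 'M[R]_(a, b)) : R :=
  \sum_i \sum_j A i j * B i j.

Definition norm2 (n : nat) (x : 'cV[R]_n) : R := Num.sqrt (inner x x).

(* Matrix 2-norm, i.e. the operator norm induced by norm2. *)
Definition opnorm2 (a b : nat) (A : 'M[R]_(a, b)) : R :=
  sup [set norm2 (A *m v) | v in [set v : 'cV[R]_b | norm2 v <= 1]].

Definition finite_second_moment (n : nat) (r : 'cV[R]_n -> R) : Prop :=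
  (expectation r (fun x => (norm2 x ^+ 2)%R) < +oo)%E.

Definition unitv (n : nat) (i : 'I_n) : 'cV[R]_n := delta_mx i 0.

Definition grad (n : nat) (h : 'cV[R]_n -> R) (x : 'cV[R]_n) : 'cV[R]_n :=
  \col_i 'D_(unitv i) h x.

Definition Hess (n : nat) (h : 'cV[R]_n -> R) (x : 'cV[R]_n) : 'M[R]_n :=
  \matrix_(i, j) 'D_(unitv i) ('D_(unitv j) h) x.

Definition divergence (n : nat) (v : 'cV[R]_n -> 'cV[R]_n) (x : 'cV[R]_n) : R :=
  \sum_i 'D_(unitv i) (fun y => v y i 0) x.

Definition wlaplacian (n : nat) (A : 'cV[R]_n -> 'M[R]_n) (r : 'cV[R]_n -> R)
    (x : 'cV[R]_n) : R :=
  \sum_i \sum_j 'D_(unitv i) ('D_(unitv j) (fun y => A y i j * r y)) x.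

Definition C2 (n : nat) (h : 'cV[R]_n -> R) : Prop :=
  [/\ continuous h,
      forall i x, derivable h x (unitv i),
      forall i, continuous ('D_(unitv i) h),
      forall i j x, derivable ('D_(unitv j) h) x (unitv i) &
      forall i j, continuous ('D_(unitv i) ('D_(unitv j) h))].

Section horizon.
Variables t0 t1 : R.

(* Functions on [t0, t1] x R^n are total functions R -> 'cV[R]_n -> _ of which
   only the values on the horizon matter: the time derivative is relative to
   [t0, t1], hence one-sided at t0 and t1. *)
Definition time_quotient (h : R -> R) (t s : R) : R := (h s - h t) / (s - t).

Definition time_derivable (h : R -> R) (t : R) : Prop :=
  cvg (time_quotient h t s @[s --> within `[t0, t1] t^']).

Definition dtime (h : R -> R) (t : R) : R :=
  lim (time_quotient h t s @[s --> within `[t0, t1] t^']).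

Definition C1_time (h : R -> R) : Prop :=
  (forall t, t0 <= t <= t1 -> time_derivable h t) /\
  {within `[t0, t1], continuous (dtime h)}.

Definition C12 (n : nat) (h : R -> 'cV[R]_n -> R) : Prop :=
  (forall x, C1_time (h ^~ x)) /\ (forall t, t0 <= t <= t1 -> C2 (h t)).

(* All the derivatives entering d_t r + div (r b) - 1/2 Delta_A r exist. *)
Definition transport_derivable (n : nat) (b : R -> 'cV[R]_n -> 'cV[R]_n)
    (A : R -> 'cV[R]_n -> 'M[R]_n) (r : R -> 'cV[R]_n -> R)
    (t : R) (x : 'cV[R]_n) : Prop :=
  [/\ time_derivable (r ^~ x) t,
      forall i, derivable (fun y => (r t y *: b t y) i 0) x (unitv i),
      forall i j y, derivable (fun y => A t y i j * r t y) y (unitv j) &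
      forall i j,
        derivable ('D_(unitv j) (fun y => A t y i j * r t y)) x (unitv i)].

(* Classical solutions, on the open time interval: r need not have derivatives
   at t0 and t1, where it takes prescribed, possibly non-smooth, values. *)
Definition fokker_planck (n : nat) (b : R -> 'cV[R]_n -> 'cV[R]_n)
    (A : R -> 'cV[R]_n -> 'M[R]_n) (r : R -> 'cV[R]_n -> R) : Prop :=
  forall t x, t0 < t < t1 ->
    transport_derivable b A r t x /\
    dtime (r ^~ x) t + divergence (fun y => r t y *: b t y) x
    = 2^-1 * wlaplacian (A t) (r t) x.
End horizon.

Section bridge.
Variables (n m p : nat) (t0 t1 : R).
Variables (f : R -> 'cV[R]_n -> 'cV[R]_n) (g : R -> 'cV[R]_n -> 'M[R]_(n, m)).
Variables (sigma : R -> 'cV[R]_n -> 'M[R]_(n, p)) (q : R -> 'cV[R]_n -> R).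
Variables (rho0 rho1 : 'cV[R]_n -> R).

Definition diffusion (t : R) (x : 'cV[R]_n) : 'M[R]_n :=
  sigma t x *m (sigma t x)^T.

Definition assumption_A1 : Prop :=
  exists c1 c2 : R, [/\ 0 < c1, 0 < c2 &
    forall (t : R) (x y : 'cV[R]_n), t0 <= t <= t1 ->
      norm2 (f t x) + opnorm2 (sigma t x) <= c1 * (1 + norm2 x) /\
      norm2 (f t x - f t y) <= c2 * norm2 (x - y)].

Definition assumption_A2 : Prop :=
  exists2 c3 : R, 0 < c3 &
    forall (t : R) (x : 'cV[R]_n), t0 <= t <= t1 ->
      c3 * norm2 x ^+ 2 <= inner x (diffusion t x *m x).

(* Continuity of a density curve is for the narrow topology. *)
Definition density_curve (r : R -> 'cV[R]_n -> R) : Prop :=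
  [/\ forall t, t0 <= t <= t1 -> is_pdf (r t),
      forall h : 'cV[R]_n -> R, continuous h -> (exists M, forall x, `|h x| <= M) ->
        {within `[t0, t1], continuous (fun t => expectation (r t) h)},
      forall x, r t0 x = rho0 x &
      forall x, r t1 x = rho1 x].

(* Markovian inputs of finite energy along the density curve r. *)
Definition admissible_control (r : R -> 'cV[R]_n -> R)
    (u : R -> 'cV[R]_n -> 'cV[R]_m) : Prop :=
  (forall i, measurable_fun
     (`[t0, t1] `*` [set: n.-tuple (measurableTypeR R)])
     (fun z : measurableTypeR R * n.-tuple (measurableTypeR R) =>
        u z.1 (vec_of_tuple z.2) i 0)) /\
  (\int[@lebesgue_measure R]_(t in `[t0, t1])
     expectation (r t) (fun x => (norm2 (u t x) ^+ 2)%R) < +oo)%E.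

Definition running_cost (u : R -> 'cV[R]_n -> 'cV[R]_m) (t : R) (x : 'cV[R]_n) : R :=
  q t x + 2^-1 * norm2 (u t x) ^+ 2.

Definition bridge_cost (r : R -> 'cV[R]_n -> R) (u : R -> 'cV[R]_n -> 'cV[R]_m) :
    \bar R :=
  (\int[@lebesgue_measure R]_(t in `[t0, t1]) expectation (r t) (running_cost u t))%E.

(* The cost is not of the form (+oo) - (+oo). *)
Definition bridge_cost_defined (r : R -> 'cV[R]_n -> R)
    (u : R -> 'cV[R]_n -> 'cV[R]_m) : Prop :=
  (\int[@lebesgue_measure R]_(t in `[t0, t1])
     expectation (r t) (fun x => Num.max (running_cost u t x) 0%R) < +oo)%E \/
  (\int[@lebesgue_measure R]_(t in `[t0, t1])
     expectation (r t) (fun x => Num.max (- running_cost u t x)%R 0%R) < +oo)%E.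

Definition controlled_drift (u : R -> 'cV[R]_n -> 'cV[R]_m) (t : R)
    (x : 'cV[R]_n) : 'cV[R]_n := f t x + g t x *m u t x.

Definition bridge_feasible (r : R -> 'cV[R]_n -> R)
    (u : R -> 'cV[R]_n -> 'cV[R]_m) : Prop :=
  [/\ density_curve r, admissible_control r u, bridge_cost_defined r u &
      fokker_planck t0 t1 (controlled_drift u) diffusion r].

Definition bridge_minimizer (r : R -> 'cV[R]_n -> R)
    (u : R -> 'cV[R]_n -> 'cV[R]_m) : Prop :=
  bridge_feasible r u /\
  forall r' u', bridge_feasible r' u' -> (bridge_cost r u <= bridge_cost r' u')%E.
End bridge.

End euclidean.

(* Main.v *)
(* Conjugating the Fokker-Planck operator of drift b and diffusion A by exp s,
   i.e. writing it on rho * exp s, turns b into b + A grad s and adds the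
   potential <grad s, b> + <grad s, A grad s> / 2 + <A, Hess s> / 2.  With
   s = - S / lambda the Hamilton-Jacobi-Bellman equation for S says that this
   potential plus ds/dt equals - (q / lambda + q_phi).  The same equation,
   rewritten for exp (S / lambda), is the backward equation. *)

Require Import Defs.
From HB Require Import structures.
From mathcomp Require Import all_boot all_order all_algebra.
From mathcomp Require Import all_classical all_reals all_analysis.
From mathcomp Require Import ring lra.

Set Implicit Arguments.
Unset Strict Implicit.
Unset Printing Implicit Defensive.

Import Order.TTheory GRing.Theory Num.Theory.
Import numFieldNormedType.Exports.

Local Open Scope classical_set_scope.
Local Open Scope ring_scope.

Section directional_derivatives.
Context {R : realType} {V : normedModType R}.
Implicit Types (x v : V) (a b h : V -> R).

Lemma is_derive_add a b x v da db :
  is_derive x v a da -> is_derive x v b db ->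
  is_derive x v (fun y => a y + b y) (da + db).
Proof. exact: is_deriveD. Qed.

Lemma is_derive_mul a b x v da db :
  is_derive x v a da -> is_derive x v b db ->
  is_derive x v (fun y => a y * b y) (da * b x + a x * db).
Proof.
move=> ha hb; apply: (is_derive_eq (is_deriveM ha hb)).
by rewrite /GRing.scale /= addrC [b x * _]mulrC.
Qed.

Lemma is_derive_bigsum k (h : 'I_k -> V -> R) (dh : 'I_k -> R) x v :
  (forall i, is_derive x v (h i) (dh i)) ->
  is_derive x v (fun y => \sum_i h i y) (\sum_i dh i).
Proof.
move=> H; rewrite (_ : (fun y => _) = \sum_i h i); first exact: (is_derive_sum H).
by apply/funext => y; rewrite fct_sumE.
Qed.

Lemma is_derive_exp h x v dh :
  is_derive x v h dh ->
  is_derive x v (fun y => expR (h y)) (expR (h x) * dh).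
Proof.
have lineE (k : V -> R) : 'D_1 (fun s : R => k (s *: v + x)) 0 = 'D_v k x.
  rewrite /derive; set u := fun s => s^-1 *: _; set w := fun s => s^-1 *: _.
  suff -> : u = w by []; apply/funext => s; rewrite /u /w /=.
  by rewrite scale0r add0r addr0 [s *: _]mulr1.
move=> [dx <-] {dh}.
pose g (s : R) := h (s *: v + x).
have Dg : is_derive (0 : R) 1 g ('D_v h x).
  by rewrite -lineE; apply: derivableP; exact: (derivable1P _ _ _).1.
have Dexp : is_derive (g 0) 1 expR (expR (g 0)) by exact: is_derive_expR.
have [dxe dve] := is_derive1_comp Dexp Dg.
rewrite -/(g 0) /g scale0r add0r in dve.
split; first exact: (derivable1P _ _ _).2.
by rewrite -dve -lineE.
Qed.

End directional_derivatives.

Section time_derivatives.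
Context {R : realType} (t0 t1 : R).
Implicit Types (h k : R -> R) (t : R).
Context (t01 : t0 < t1).

Let F t := within `[t0, t1] t^'.

#[local] Instance time_filter t : Filter (F t).
Proof. exact: within_filter. Qed.

Lemma time_filter_proper t : t0 <= t <= t1 -> ProperFilter (F t).
Proof.
move=> /andP[h0 h1]; split; last exact: time_filter.
rewrite /F /within /= /dnbhs /within => /nbhs_ballP[e /= e0 be].
have [tt1|tt1] := ltP t t1.
  pose y := Num.min t1 (t + e / 2).
  have ty : t < y by rewrite lt_min tt1 /=; lra.
  apply: (be y).
  - rewrite /ball /= distrC gtr0_norm ?subr_gt0//.
    have : y <= t + e / 2 by rewrite ge_min lexx orbT.
    lra.
  - by rewrite gt_eqF.
  - by rewrite /= in_itv /= (le_trans h0 (ltW ty)) ge_min lexx.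
pose y := Num.max t0 (t - e / 2).
have tt : t0 < t by apply: lt_le_trans t01 tt1.
have ty : y < t by rewrite gt_max tt /=; lra.
apply: (be y).
- rewrite /ball /= gtr0_norm ?subr_gt0//.
  have : t - e / 2 <= y by rewrite le_max lexx orbT.
  lra.
- by rewrite lt_eqF.
- by rewrite /= in_itv /= (le_trans (ltW ty) h1) le_max lexx.
Qed.

Definition is_dtime h t (l : R) := time_quotient h t s @[s --> F t] --> l.

Lemma is_dtimeE h t l : t0 <= t <= t1 -> is_dtime h t l ->
  time_derivable t0 t1 h t /\ dtime t0 t1 h t = l.
Proof.
move=> tI hl; have PF := time_filter_proper tI.
split; first by apply/cvg_ex; exists l.
exact: cvg_lim.
Qed.

Lemma dtimeP h t : time_derivable t0 t1 h t -> is_dtime h t (dtime t0 t1 h t).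
Proof. by []. Qed.

Lemma near_time_neq t : \forall s \near F t, s != t.
Proof.
by rewrite /F near_withinE; apply: filterS (nbhs_dnbhs_neq t) => s st _.
Qed.

Lemma is_dtime_cvg h t l : is_dtime h t l -> h s @[s --> F t] --> h t.
Proof.
move=> hl.
have c : h t + time_quotient h t s * (s - t) @[s --> F t] --> h t + l * (t - t).
  have st : s @[s --> F t] --> t by do 2 apply: cvg_within_filter.
  apply: cvgD; first exact: cvg_cst.
  by apply: cvgM => //; apply: cvgB => //; exact: cvg_cst.
rewrite subrr mulr0 addr0 in c.
apply: cvg_trans c; apply: near_eq_cvg.
near=> s.
have st : s != t by near: s; exact: near_time_neq.
by rewrite /time_quotient divfK ?subr_eq0// addrC subrK.
Unshelve. all: by end_near. Qed.

Lemma is_dtime_mul h k t a b : is_dtime h t a -> is_dtime k t b ->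
  is_dtime (fun s => h s * k s) t (a * k t + h t * b).
Proof.
move=> ha kb; rewrite /is_dtime.
rewrite (_ : time_quotient _ t =
  fun s => time_quotient h t s * k s + h t * time_quotient k t s).
  apply: cvgD; apply: cvgM => //; first exact: is_dtime_cvg kb.
  exact: cvg_cst.
by apply/funext => s; rewrite /time_quotient; ring.
Qed.

Lemma is_dtime_cst c t : is_dtime (fun=> c) t 0.
Proof.
rewrite /is_dtime (_ : time_quotient _ t = fun=> 0); first exact: cvg_cst.
by apply/funext => s; rewrite /time_quotient subrr mul0r.
Qed.

Lemma is_dtime_divc h c t a : is_dtime h t a ->
  is_dtime (fun s => h s / c) t (a / c).
Proof.
by move=> /is_dtime_mul /(_ (is_dtime_cst c^-1 t)); rewrite mulr0 addr0.
Qed.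

Lemma is_dtime_exp h t a : is_dtime h t a ->
  is_dtime (fun s => expR (h s)) t (expR (h t) * a).
Proof.
move=> ha.
pose slope y := if y == h t then expR (h t)
                else (expR y - expR (h t)) / (y - h t).
have slopet : slope (h t) = expR (h t) by rewrite /slope eqxx.
have cslope : slope y @[y --> h t] --> expR (h t).
  have [dx dv] := is_derive_expR (h t).
  rewrite -slopet; apply/(continuous_withinNshiftx slope (h t)).
  rewrite slopet -dv.
  apply: cvg_trans dx; apply: near_eq_cvg; near=> s.
  have s0 : s != 0 by near: s; exact: nbhs_dnbhs_neq.
  rewrite /slope /= /shift -subr_eq0 addrK (negPf s0) [s *: 1]mulr1.
  by rewrite [_ *: _]mulrC.
rewrite /is_dtime (_ : time_quotient _ t =
  fun s => slope (h s) * time_quotient h t s).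
  apply: cvgM => //.
  by apply: cvg_comp cslope; exact: is_dtime_cvg ha.
apply/funext => s; rewrite /time_quotient /slope.
have [->|hne] := eqVneq (h s) (h t); first by rewrite !subrr !mul0r mulr0.
by rewrite mulrA divfK // subr_eq0.
Unshelve. all: by end_near. Qed.

Lemma within_eq_continuous h k :
  {in `[t0, t1], h =1 k} -> {within `[t0, t1], continuous h} ->
  {within `[t0, t1], continuous k}.
Proof.
by move=> hk; apply: subspace_eq_continuous => t /set_mem; exact: hk.
Qed.

Lemma time_derivable_continuous h :
  (forall t, t0 <= t <= t1 -> time_derivable t0 t1 h t) ->
  {within `[t0, t1], continuous h}.
Proof.
move=> dh; apply/subspace_continuousP => t tI.
have /dh/dtimeP/is_dtime_cvg ch : t0 <= t <= t1 by move: tI; rewrite /= in_itv.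
move=> P Pt.
have Q : \forall s \near nbhs t, s != t -> `[t0, t1]%classic s -> P (h s).
  exact: ch P Pt.
have: \forall s \near nbhs t, `[t0, t1]%classic s -> P (h s); last by [].
apply: filterS Q => s Ps; have [-> _|st] := eqVneq s t; last exact: Ps.
exact: nbhs_singleton.
Qed.

Lemma C1_time_exp h c : C1_time t0 t1 h ->
  C1_time t0 t1 (fun s => expR (h s / c)).
Proof.
move=> [dh ch].
have D t : t0 <= t <= t1 -> is_dtime (fun s => expR (h s / c)) t
    (expR (h t / c) * (dtime t0 t1 h t / c)).
  by move=> tI; apply/is_dtime_exp/is_dtime_divc/dtimeP/dh.
split=> [t tI|]; first by have [] := is_dtimeE tI (D _ tI).
apply: (@within_eq_continuous
    (fun t => expR (h t / c) * (dtime t0 t1 h t / c))).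
  by move=> t; rewrite in_itv /= => tI; have [_ ->] := is_dtimeE tI (D _ tI).
have /subspace_continuousP hc := time_derivable_continuous dh.
move/subspace_continuousP in ch.
apply/subspace_continuousP => t tI; apply: cvgM.
  apply: (@cvg_comp _ _ _ (fun t => h t / c : R) expR); last first.
    exact: continuous_expR.
  by apply: cvgM; [exact: hc|exact: cvg_cst].
by apply: cvgM; [exact: ch|exact: cvg_cst].
Qed.

End time_derivatives.

Section continuity.
Context {R : realType} {T : topologicalType}.
Implicit Types a b : T -> R.

Lemma continuous_mul a b :
  continuous a -> continuous b -> continuous (fun y => a y * b y).
Proof. by move=> ca cb x; apply: continuousM; [exact: ca|exact: cb]. Qed.

Lemma continuous_add a b :
  continuous a -> continuous b -> continuous (fun y => a y + b y).
Proof. by move=> ca cb x; apply: continuousD; [exact: ca|exact: cb]. Qed.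

Lemma continuous_divc a (c : R) :
  continuous a -> continuous (fun y => a y / c).
Proof. by move=> ca; apply: continuous_mul => // y; exact: cvg_cst. Qed.

Lemma continuous_exp a : continuous a -> continuous (fun y => expR (a y)).
Proof.
move=> ca x; apply: continuous_comp; first exact: ca.
exact: continuous_expR.
Qed.

End continuity.

Section space_derivatives.
Context {R : realType} {n : nat}.
Implicit Types (x : 'cV[R]_n) (h s rho : 'cV[R]_n -> R) (c : R).

Lemma is_derive_divc h x v dh c :
  is_derive x v h dh -> is_derive x v (fun y => h y / c) (dh / c).
Proof.
move=> hd; apply: (is_derive_eq (is_derive_mul hd (is_derive_cst c^-1 x v))).
by rewrite mulr0 addr0.
Qed.

Lemma C2_is_derive h : C2 h ->
  forall i x, is_derive x (unitv i) h (grad h x i 0).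
Proof. by move=> [_ dh _ _ _] i x; rewrite mxE; apply: derivableP. Qed.

Lemma C2_is_derive2 h : C2 h -> forall i j x,
  is_derive x (unitv i) (fun y => grad h y j 0) (Hess h x i j).
Proof.
move=> [_ _ _ dh _] i j x; rewrite mxE.
rewrite (_ : (fun y => _) = 'D_(unitv j) h); first exact: derivableP.
by apply/funext => y; rewrite mxE.
Qed.

Lemma grad_divc h c x : C2 h -> grad (fun y => h y / c) x = c^-1 *: grad h x.
Proof.
move=> hC; apply/matrixP => i j; rewrite !mxE.
have /= := is_derive_divc c (C2_is_derive hC i x).
by case=> _ ->; rewrite mxE mulrC.
Qed.

Lemma Hess_divc h c x : C2 h -> Hess (fun y => h y / c) x = c^-1 *: Hess h x.
Proof.
move=> hC; apply/matrixP => i j; rewrite !mxE.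
have -> : 'D_(unitv j) (fun y => h y / c) = fun y => grad h y j 0 / c.
  apply/funext => y; have := congr1 (fun G : 'cV_n => G j 0) (grad_divc c y hC).
  by rewrite !mxE => ->; rewrite mulrC.
have /= := is_derive_divc c (C2_is_derive2 hC i j x).
by case=> _ ->; rewrite mxE mulrC.
Qed.

Lemma C2_intro h (dh : 'I_n -> 'cV[R]_n -> R)
    (ddh : 'I_n -> 'I_n -> 'cV[R]_n -> R) :
  continuous h ->
  (forall i x, is_derive x (unitv i) h (dh i x)) ->
  (forall i, continuous (dh i)) ->
  (forall i j x, is_derive x (unitv i) (dh j) (ddh i j x)) ->
  (forall i j, continuous (ddh i j)) -> C2 h.
Proof.
move=> ch hd cd hdd cdd.
have E1 i : 'D_(unitv i) h = dh i by apply/funext => x; have [] := hd i x.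
have E2 i j : 'D_(unitv i) ('D_(unitv j) h) = ddh i j.
  by apply/funext => x; rewrite E1; have [] := hdd i j x.
split => //.
- by move=> i; rewrite E1.
- by move=> i j x; rewrite E1; have [] := hdd i j x.
- by move=> i j; rewrite E2.
Qed.

Lemma grad_continuous h : C2 h -> forall i, continuous (fun x => grad h x i 0).
Proof.
move=> [_ _ ch _ _] i; rewrite (_ : (fun x => _) = 'D_(unitv i) h) //.
by apply/funext => y; rewrite mxE.
Qed.

Lemma Hess_continuous h : C2 h -> forall i j, continuous (fun x => Hess h x i j).
Proof.
move=> [_ _ _ _ ch] i j; rewrite (_ : (fun x => _) =
  'D_(unitv i) ('D_(unitv j) h)) //.
by apply/funext => y; rewrite mxE.
Qed.

Lemma C2_divc h c : C2 h -> C2 (fun y => h y / c).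
Proof.
move=> hC; have [ch _ _ _ _] := hC.
apply: (C2_intro (dh := fun i y => grad h y i 0 / c)
  (ddh := fun i j y => Hess h y i j / c)).
- exact: continuous_divc.
- by move=> i x; apply: is_derive_divc; exact: C2_is_derive.
- by move=> i; apply: continuous_divc; exact: grad_continuous.
- by move=> i j x; apply: is_derive_divc; exact: C2_is_derive2.
- by move=> i j; apply: continuous_divc; exact: Hess_continuous.
Qed.

Section exponential.
Context (s : 'cV[R]_n -> R) (sC : C2 s).
Let E x := expR (s x).

Let E_continuous : continuous E.
Proof. by apply: continuous_exp; case: sC. Qed.

Let is_deriveE i x : is_derive x (unitv i) E (E x * grad s x i 0).
Proof. by apply: is_derive_exp; exact: C2_is_derive. Qed.

Let is_derive2E i j x : is_derive x (unitv i) (fun y => E y * grad s y j 0)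
  (E x * (grad s x i 0 * grad s x j 0 + Hess s x i j)).
Proof.
apply: (is_derive_eq (is_derive_mul (is_deriveE i x) (C2_is_derive2 sC i j x))).
by ring.
Qed.

Lemma C2_exp : C2 E.
Proof.
apply: (C2_intro (dh := fun j y => E y * grad s y j 0) (ddh := fun i j x =>
  E x * (grad s x i 0 * grad s x j 0 + Hess s x i j))) => //.
- by move=> i; apply: continuous_mul => //; exact: grad_continuous.
- move=> i j; apply: continuous_mul => //; apply: continuous_add.
    by apply: continuous_mul; exact: grad_continuous.
  exact: Hess_continuous.
Qed.

Lemma grad_exp x : grad E x = E x *: grad s x.
Proof.
apply/matrixP => i j; rewrite [LHS]mxE [RHS]mxE (ord1 j).
by have [_ ->] := is_deriveE i x.
Qed.

Lemma Hess_exp x : Hess E x = E x *: (grad s x *m (grad s x)^T + Hess s x).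
Proof.
apply/matrixP => i j; rewrite [LHS]mxE.
have -> : 'D_(unitv j) E = fun y => E y * grad s y j 0.
  by apply/funext => y; have [] := is_deriveE j y.
have [_ ->] := is_derive2E i j x.
by rewrite !mxE big_ord1 !mxE.
Qed.

End exponential.

Lemma outer_productE (u : 'cV[R]_n) i j : (u *m u^T) i j = u i 0 * u j 0.
Proof. by rewrite mxE big_ord1 mxE. Qed.

Lemma inner_quadratic (A : 'M[R]_n) (u : 'cV[R]_n) :
  inner u (A *m u) = inner A (u *m u^T).
Proof.
apply: eq_bigr => i _; rewrite big_ord1 mxE mulr_sumr.
by apply: eq_bigr => j _; rewrite outer_productE; ring.
Qed.

Section tilting.
Context (A : 'cV[R]_n -> 'M[R]_n) (b : 'cV[R]_n -> 'cV[R]_n).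
Context (rho s : 'cV[R]_n -> R) (x : 'cV[R]_n).
Context (A_sym : forall y, (A y)^T = A y) (sC : C2 s).
Context (drift_d : forall i,
  derivable (fun y => (rho y *: b y) i 0) x (unitv i)).
Let M i j y := A y i j * rho y.
Context (M_d : forall i j y, derivable (M i j) y (unitv j)).
Context (M_dd : forall i j, derivable ('D_(unitv j) (M i j)) x (unitv i)).

Let E y := expR (s y).
Let c y := b y + A y *m grad s y.

Let M_sym i j y : M i j y = M j i y.
Proof. by rewrite /M -[in LHS]A_sym mxE. Qed.

(* Only the derivatives of [M i j] along [unitv j] are assumed; the symmetry of
   [A] supplies those along [unitv i] that the new flux requires. *)
Let M_d' i j y : derivable (M i j) y (unitv i).
Proof.
by rewrite (_ : M i j = M j i) //; apply/funext => z; exact: M_sym.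
Qed.

Let D_E i y : is_derive y (unitv i) E (E y * grad s y i 0).
Proof. by rewrite /E; apply: is_derive_exp; exact: C2_is_derive. Qed.

Let D_flux i : is_derive x (unitv i) (fun y => (rho y * E y *: c y) i 0)
  (E x * ('D_(unitv i) (fun y => (rho y *: b y) i 0) x
    + rho x * b x i 0 * grad s x i 0
    + \sum_j (M i j x * (grad s x i 0 * grad s x j 0)
              + 'D_(unitv i) (M i j) x * grad s x j 0
              + M i j x * Hess s x i j))).
Proof.
rewrite (_ : (fun y => _) = fun y => E y * ((rho y *: b y) i 0
    + \sum_j M i j y * grad s y j 0)); last first.
  apply/funext => y; rewrite !mxE -[rho y * E y]mulrC -mulrA mulrDr mulr_sumr.
  congr (_ * (_ + _)); apply: eq_bigr => j _.
  by rewrite /M mulrA [rho y * _]mulrC.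
have Dsum : is_derive x (unitv i) (fun y => \sum_j M i j y * grad s y j 0)
   (\sum_j ('D_(unitv i) (M i j) x * grad s x j 0 + M i j x * Hess s x i j)).
  apply: is_derive_bigsum => j; apply: is_derive_mul; last exact: C2_is_derive2.
  exact: derivableP.
apply: (is_derive_eq (is_derive_mul (D_E i x)
  (is_derive_add (derivableP (@drift_d i)) Dsum))).
have -> : (rho x *: b x) i 0 = rho x * b x i 0 by rewrite mxE.
rewrite [in RHS](eq_bigr (fun j => grad s x i 0 * (M i j x * grad s x j 0) +
  ('D_(unitv i) (M i j) x * grad s x j 0 + M i j x * Hess s x i j))).
  by rewrite [in RHS]big_split /= -mulr_sumr; ring.
by move=> j _; ring.
Qed.

Let D_M i j y : is_derive y (unitv j) (fun z => A z i j * (rho z * E z))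
  (E y * ('D_(unitv j) (M i j) y + M i j y * grad s y j 0)).
Proof.
rewrite (_ : (fun z => _) = fun z => M i j z * E z); last first.
  by apply/funext => z; rewrite /M mulrA.
apply: (is_derive_eq (is_derive_mul (derivableP (@M_d i j y)) (D_E j y))).
by ring.
Qed.

Let DD_M i j : is_derive x (unitv i)
  ('D_(unitv j) (fun z => A z i j * (rho z * E z)))
  (E x * ('D_(unitv i) ('D_(unitv j) (M i j)) x
     + grad s x i 0 * 'D_(unitv j) (M i j) x
     + grad s x j 0 * 'D_(unitv i) (M i j) x
     + M i j x * (grad s x i 0 * grad s x j 0)
     + M i j x * Hess s x i j)).
Proof.
rewrite (_ : 'D_(unitv j) _ = fun y =>
  E y * ('D_(unitv j) (M i j) y + M i j y * grad s y j 0)); last first.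
  by apply/funext => y; have [] := D_M i j y.
apply: (is_derive_eq (is_derive_mul (D_E i x) (is_derive_add
  (derivableP (@M_dd i j))
  (is_derive_mul (derivableP (@M_d' i j x)) (C2_is_derive2 sC i j x))))).
by ring.
Qed.

Lemma tilting_derivable :
  [/\ forall i, derivable (fun y => (rho y * E y *: c y) i 0) x (unitv i),
      forall i j y, derivable (fun z => A z i j * (rho z * E z)) y (unitv j) &
      forall i j, derivable ('D_(unitv j) (fun z => A z i j * (rho z * E z)))
                    x (unitv i)].
Proof.
split=> [i|i j y|i j]; first by have [] := D_flux i.
  by have [] := D_M i j y.
by have [] := DD_M i j.
Qed.

(* The new drift [A grad s] is exactly what cancels the first-order cross terms
   of the weighted Laplacian, so that only a potential is left. *)
Lemma tilting_operator :
  divergence (fun y => rho y * E y *: c y) x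
    - 2^-1 * wlaplacian A (fun y => rho y * E y) x
  = E x * (divergence (fun y => rho y *: b y) x - 2^-1 * wlaplacian A rho x
      + rho x * (inner (grad s x) (b x)
          + 2^-1 * inner (grad s x) (A x *m grad s x)
          + 2^-1 * inner (A x) (Hess s x))).
Proof.
pose T := \sum_i \sum_j 'D_(unitv i) (M i j) x * grad s x j 0.
have divE : divergence (fun y => rho y * E y *: c y) x = E x *
    (divergence (fun y => rho y *: b y) x + rho x * inner (grad s x) (b x)
     + rho x * inner (grad s x) (A x *m grad s x) + T
     + rho x * inner (A x) (Hess s x)).
  rewrite inner_quadratic /divergence /inner /T !mulr_sumr -!big_split /=.
  rewrite mulr_sumr.
  apply: eq_bigr => i _; have [_ ->] := D_flux i; congr (_ * _).
  rewrite big_ord1 !mulr_sumr -!addrA; congr (_ + _).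
  rewrite -!big_split /=; congr (_ + _); first by ring.
  apply: eq_bigr => j _; rewrite outer_productE /M.
  move: (A x i j) (rho x) (grad s x i 0) (grad s x j 0) (Hess s x i j)
    ('D_(unitv i) _ x) => *.
  by ring.
have lapE : wlaplacian A (fun y => rho y * E y) x = E x *
    (wlaplacian A rho x + (T + T)
     + rho x * inner (grad s x) (A x *m grad s x)
     + rho x * inner (A x) (Hess s x)).
  have T' : T = \sum_i \sum_j grad s x i 0 * 'D_(unitv j) (M i j) x.
    rewrite /T exchange_big; apply: eq_bigr => i _; apply: eq_bigr => j _.
    rewrite mulrC (_ : M j i = M i j) //; apply/funext => y; exact: M_sym.
  have -> : wlaplacian A rho x =
    \sum_i \sum_j 'D_(unitv i) ('D_(unitv j) (M i j)) x by [].
  rewrite {2}T' inner_quadratic /wlaplacian /inner /T !mulr_sumr -!big_split /=.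
  rewrite mulr_sumr; apply: eq_bigr => i _.
  rewrite !mulr_sumr -!big_split /= mulr_sumr; apply: eq_bigr => j _.
  have [_ ->] := DD_M i j.
  have -> : M i j x = A x i j * rho x by [].
  rewrite outer_productE.
  move: ('D_(unitv i) ('D_(unitv j) (M i j)) x) ('D_(unitv j) (M i j) x)
    ('D_(unitv i) (M i j) x) (grad s x i 0) (grad s x j 0) (Hess s x i j)
    (E x) => *.
  by ring.
by rewrite divE lapE; field.
Qed.

End tilting.
End space_derivatives.

Section inner_product.
Context {R : realType} {a b : nat}.
Implicit Types (A B C : 'M[R]_(a, b)) (k : R).

Lemma innerDr A B C : inner A (B + C) = inner A B + inner A C.
Proof.
rewrite /inner -big_split; apply: eq_bigr => i _; rewrite -big_split.
by apply: eq_bigr => j _; rewrite mxE mulrDr.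
Qed.

Lemma innerZr k A B : inner A (k *: B) = k * inner A B.
Proof.
rewrite /inner mulr_sumr; apply: eq_bigr => i _; rewrite mulr_sumr.
by apply: eq_bigr => j _; rewrite mxE mulrCA.
Qed.

Lemma innerZl k A B : inner (k *: A) B = k * inner A B.
Proof.
rewrite /inner mulr_sumr; apply: eq_bigr => i _; rewrite mulr_sumr.
by apply: eq_bigr => j _; rewrite mxE mulrA.
Qed.

End inner_product.

Lemma quadratic_formE (R : realType) (n : nat) (A : 'M[R]_n) (u : 'cV[R]_n) :
  (u^T *m A *m u) 0 0 = inner u (A *m u).
Proof.
by rewrite -mulmxA mxE; apply: eq_bigr => i _; rewrite big_ord1 mxE.
Qed.

Section bridge_congruence.
Context {R : realType} {n m p : nat} (t0 t1 : R).
Context (f : R -> 'cV[R]_n -> 'cV[R]_n) (g : R -> 'cV[R]_n -> 'M[R]_(n, m)).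
Context (sigma : R -> 'cV[R]_n -> 'M[R]_(n, p)) (q : R -> 'cV[R]_n -> R).
Context (rho0 rho1 : 'cV[R]_n -> R).
Context (r : R -> 'cV[R]_n -> R) (u v : R -> 'cV[R]_n -> 'cV[R]_m).
Context (uv : forall t x, t0 <= t <= t1 -> u t x = v t x).

Let uvI t : t \in `[t0, t1]%classic -> u t = v t.
Proof.
by rewrite inE /= in_itv /= => tI; apply/funext => x; exact: uv.
Qed.

Let costI t : t \in `[t0, t1]%classic -> running_cost q u t = running_cost q v t.
Proof. by move=> tI; apply/funext => x; rewrite /running_cost uvI. Qed.

Lemma bridge_cost_congr : bridge_cost t0 t1 q r u = bridge_cost t0 t1 q r v.
Proof. by apply: eq_integral => t tI; rewrite costI. Qed.

Lemma bridge_feasible_congr :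
  bridge_feasible t0 t1 f g sigma q rho0 rho1 r u ->
  bridge_feasible t0 t1 f g sigma q rho0 rho1 r v.
Proof.
move=> [rC [mu Eu] Cu FPu]; split; first exact: rC.
- split=> [i|].
    apply: eq_measurable_fun (mu i) => -[t z] /set_mem [/= tI _].
    by rewrite uvI // inE.
  apply: le_lt_trans Eu; rewrite le_eqVlt; apply/orP; left; apply/eqP.
  by apply: eq_integral => t tI; rewrite uvI.
- have CE (k : R -> R) : (\int[@lebesgue_measure R]_(t in `[t0, t1])
        Defs.expectation (r t) (fun x => k (running_cost q v t x)))%E =
      (\int[@lebesgue_measure R]_(t in `[t0, t1])
        Defs.expectation (r t) (fun x => k (running_cost q u t x)))%E.
    by apply: eq_integral => t tI; rewrite costI.
  by case: Cu => Cu; [left|right]; rewrite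
    ?(CE (fun z => Num.max z 0)) ?(CE (fun z => Num.max (- z) 0)).
- move=> t x tI; have := FPu t x tI.
  have ut : u t = v t.
    by apply: uvI; move/andP: tI => [h0 h1]; rewrite inE /= in_itv /= !ltW.
  by rewrite /transport_derivable /controlled_drift ut.
Qed.

Lemma bridge_minimizer_congr :
  bridge_minimizer t0 t1 f g sigma q rho0 rho1 r u ->
  bridge_minimizer t0 t1 f g sigma q rho0 rho1 r v.
Proof.
move=> [Fu mu]; split; first exact: bridge_feasible_congr.
by move=> r' u' F'; rewrite -bridge_cost_congr; exact: mu.
Qed.

End bridge_congruence.

Lemma diffusion_sym (R : realType) (n p : nat)
    (sigma : R -> 'cV[R]_n -> 'M[R]_(n, p)) t x :
  (diffusion sigma t x)^T = diffusion sigma t x.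
Proof. by rewrite /diffusion trmx_mul trmxK. Qed.

Theorem theorem2 (R : realType) (n m p : nat) (t0 t1 : R)
    (f : R -> 'cV[R]_n -> 'cV[R]_n) (g : R -> 'cV[R]_n -> 'M[R]_(n, m))
    (sigma : R -> 'cV[R]_n -> 'M[R]_(n, p)) (q : R -> 'cV[R]_n -> R)
    (rho0 rho1 : 'cV[R]_n -> R)
    (rho_opt S : R -> 'cV[R]_n -> R) (u_opt : R -> 'cV[R]_n -> 'cV[R]_m)
    (lambda : R) :
  let Sigma := diffusion sigma in
  t0 < t1 ->
  assumption_A1 t0 t1 f sigma ->
  assumption_A2 t0 t1 sigma ->
  is_pdf rho0 -> finite_second_moment rho0 ->
  is_pdf rho1 -> finite_second_moment rho1 ->
  {within `[t0, t1] `*` [set: 'cV[R]_n],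
    continuous (fun z : R * 'cV[R]_n => q z.1 z.2)} ->
  C12 t0 t1 S ->
  (* optimality system for (rho_opt, S) *)
  fokker_planck t0 t1
    (fun t x => f t x + g t x *m (g t x)^T *m grad (S t) x) Sigma rho_opt ->
  (forall t x, t0 <= t <= t1 ->
    dtime t0 t1 (S ^~ x) t + inner (grad (S t) x) (f t x)
    + 2^-1 * inner (grad (S t) x) (g t x *m (g t x)^T *m grad (S t) x)
    + 2^-1 * inner (Sigma t x) (Hess (S t) x)
    = q t x) ->
  (forall x, rho_opt t0 x = rho0 x) ->
  (forall x, rho_opt t1 x = rho1 x) ->
  (forall t x, t0 <= t <= t1 -> u_opt t x = (g t x)^T *m grad (S t) x) ->
  0 < lambda ->
  let phihat := fun t x => rho_opt t x * expR (- S t x / lambda) in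
  let phi := fun t x => expR (S t x / lambda) in
  let grad_log_phi := fun t => grad (fun x => ln (phi t x)) in
  let f_phi := fun t x =>
    (lambda *: (g t x *m (g t x)^T) - Sigma t x) *m grad_log_phi t x in
  let q_phi := fun t x =>
    2^-1 * ((grad_log_phi t x)^T
            *m (lambda *: (g t x *m (g t x)^T) - Sigma t x)
            *m grad_log_phi t x) 0 0 in
  [/\ (* forward equation *)
      forall t x, t0 < t < t1 ->
        transport_derivable t0 t1 (fun s y => f s y + f_phi s y) Sigma phihat t x /\
        dtime t0 t1 (phihat ^~ x) t
        + divergence (fun y => phihat t y *: (f t y + f_phi t y)) x
        - 2^-1 * wlaplacian (Sigma t) (phihat t) x
        + (q t x / lambda + q_phi t x) * phihat t x = 0,
      (* backward equation *)
      C12 t0 t1 phi /\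
      forall t x, t0 <= t <= t1 ->
        dtime t0 t1 (phi ^~ x) t
        + inner (grad (phi t) x) (f t x + f_phi t x)
        + 2^-1 * inner (Sigma t x) (Hess (phi t) x)
        - (q t x / lambda + q_phi t x) * phi t x = 0,
      (* boundary conditions *)
      (forall x, phihat t0 x * phi t0 x = rho0 x) /\
      (forall x, phihat t1 x * phi t1 x = rho1 x),
      (* recovery of the optimal pair *)
      forall t x, t0 <= t <= t1 ->
        rho_opt t x = phihat t x * phi t x /\
        u_opt t x = lambda *: ((g t x)^T *m grad_log_phi t x) &
      bridge_minimizer t0 t1 f g sigma q rho0 rho1 rho_opt u_opt ->
      bridge_minimizer t0 t1 f g sigma q rho0 rho1
        (fun t x => phihat t x * phi t x)
        (fun t x => lambda *: ((g t x)^T *m grad_log_phi t x))].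
Proof.
move=> Sigma t01 _ _ _ _ _ _ _ [St SC] FP HJB r0 r1 uE l0.
move=> phihat phi grad_log_phi f_phi q_phi.
have lN0 : lambda != 0 by rewrite gt_eqF.
have glpE t x : t0 <= t <= t1 -> grad_log_phi t x = lambda^-1 *: grad (S t) x.
  move=> tI; rewrite /grad_log_phi (_ : (fun x => _) = fun x => S t x / lambda).
    exact/grad_divc/SC.
  by apply/funext => y; rewrite /phi expRK.
have phihatE t x : phihat t x = rho_opt t x * expR (S t x / - lambda).
  by rewrite /phihat invrN mulrN mulNr.
have phiK t x : phihat t x * phi t x = rho_opt t x.
  by rewrite /phihat /phi -mulrA -expRD mulNr addNr expR0 mulr1.
have q_phiE t x : t0 <= t <= t1 -> q_phi t x = 2^-1 * (lambda^-1 *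
    inner (grad (S t) x) (g t x *m (g t x)^T *m grad (S t) x)
    - lambda^-1 ^+ 2 * inner (grad (S t) x) (Sigma t x *m grad (S t) x)).
  move=> tI; rewrite /q_phi quadratic_formE glpE // mulmxBl -scaleN1r innerDr.
  rewrite innerZr -scalemxAl innerZr -!scalemxAr !innerZr !innerZl.
  by field.
have driftE t x : t0 <= t <= t1 -> f t x + f_phi t x =
    f t x + g t x *m (g t x)^T *m grad (S t) x
    - lambda^-1 *: (Sigma t x *m grad (S t) x).
  move=> tI; rewrite /f_phi glpE // mulmxBl -scalemxAl -!scalemxAr scalerA.
  by rewrite mulfV // scale1r addrA.
have optE t x : t0 <= t <= t1 ->
    u_opt t x = lambda *: ((g t x)^T *m grad_log_phi t x).
  by move=> tI; rewrite glpE // -scalemxAr scalerA mulfV // scale1r uE.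
split.
- move=> t x tO; have [[rt drift_d M_d M_dd] FPE] := FP t x tO.
  have tI : t0 <= t <= t1 by case/andP: tO => ? ?; rewrite !ltW.
  have sC := C2_divc (- lambda) (SC _ tI).
  have [E_flux E_M E_MM] := tilting_derivable
    (fun y => diffusion_sym sigma t y) sC drift_d M_d M_dd.
  have opE := tilting_operator
    (fun y => diffusion_sym sigma t y) sC drift_d M_d M_dd.
  have phihatt : phihat t = fun y => rho_opt t y * expR (S t y / - lambda).
    by apply/funext => y.
  pose c y := f t y + g t y *m (g t y)^T *m grad (S t) y
    + Sigma t y *m grad (fun z => S t z / - lambda) y.
  have fluxE y : phihat t y *: (f t y + f_phi t y) =
      (rho_opt t y * expR (S t y / - lambda)) *: c y.
    rewrite phihatE driftE // /c grad_divc; last exact: SC.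
    by rewrite -scalemxAr invrN scaleNr.
  have Dt : is_dtime t0 t1 (phihat ^~ x) t
      (dtime t0 t1 (rho_opt ^~ x) t * expR (S t x / - lambda)
       + rho_opt t x * (expR (S t x / - lambda)
                        * (dtime t0 t1 (S ^~ x) t / - lambda))).
    rewrite (_ : phihat ^~ x = fun s => rho_opt s x * expR (S s x / - lambda)).
      apply: is_dtime_mul; first exact: dtimeP.
      exact/is_dtime_exp/is_dtime_divc/dtimeP/(St x).1.
    by apply/funext => s.
  have [dt dtE] := is_dtimeE t01 tI Dt.
  split.
    split; first exact: dt.
    + move=> i.
      have -> : (fun y => (phihat t y *: (f t y + f_phi t y)) i 0) =
          fun y => ((rho_opt t y * expR (S t y / - lambda)) *: c y) i 0.
        by apply/funext => y; rewrite fluxE.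
      exact: E_flux.
    + by move=> i j y; rewrite phihatt; exact: E_M.
    + by move=> i j; rewrite phihatt; exact: E_MM.
  rewrite dtE (funext fluxE) phihatt -[_ + divergence _ _ - _]addrA opE q_phiE //.
  rewrite -HJB // grad_divc ?Hess_divc; try exact: SC.
  rewrite -scalemxAr !(innerZl, innerZr, innerDr) invrN.
  have -> : divergence (fun y => rho_opt t y *:
      (f t y + g t y *m (g t y)^T *m grad (S t) y)) x =
      2^-1 * wlaplacian (Sigma t) (rho_opt t) x - dtime t0 t1 (rho_opt ^~ x) t.
    by rewrite -FPE addrC addKr.
  by field.
- split.
    split=> [x|t tI]; first exact: C1_time_exp.
    by apply: C2_exp; exact/C2_divc/SC.
  move=> t x tI.
  have sC := C2_divc lambda (SC _ tI).
  have Dt : is_dtime t0 t1 (phi ^~ x) t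
      (phi t x * (dtime t0 t1 (S ^~ x) t / lambda)).
    exact/is_dtime_exp/is_dtime_divc/dtimeP/(St x).1.
  have [_ ->] := is_dtimeE t01 tI Dt.
  rewrite driftE // q_phiE // -HJB // /phi grad_exp // Hess_exp //.
  rewrite -scaleN1r !(innerZl, innerZr, innerDr) -inner_quadratic.
  rewrite grad_divc ?Hess_divc; try exact: SC.
  rewrite -scalemxAr !(innerZl, innerZr).
  by field.
- by split=> x; rewrite phiK.
- by move=> t x tI; split; [rewrite phiK|exact: optE].
- have -> : (fun t x => phihat t x * phi t x) = rho_opt.
    by apply/funext => t; apply/funext => x.
  exact: bridge_minimizer_congr.
Qed.
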